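(* Let $P$ be a $2$-dimensional lattice polytope with Ehrhart polynomial $i_P$. Then every root of $i_P$ lies in the set \[ \left\{-2,\,-1,\,-\tfrac{2}{3}\right\}\ \cup\ \left\{x+iy\in\mathbb{C}:\ -\tfrac12\le x<0,\ |y|\le \tfrac{\sqrt{15}}{6}\right\}. \]
   Context: A lattice polytope is a convex polytope whose vertices have integer coordinates. Its Ehrhart polynomial $i_P$ is the polynomial satisfying $i_P(n)=\#(nP\cap\mathbb{Z}^2)$ for all nonnegative integers $n$ (for $P\subset\mathbb{R}^2$). *)

(* Defs.v *)
From HB Require Import structures.
From mathcomp Require Import all_boot all_order all_algebra.
From mathcomp Require Import finmap.
From mathcomp Require Import boolp classical_sets functions cardinality.
From mathcomp Require Import reals convex.
From mathcomp Require Import complex.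

Set Implicit Arguments.
Unset Strict Implicit.
Unset Printing Implicit Defensive.

Import Order.TTheory GRing.Theory Num.Theory.

Local Open Scope classical_set_scope.
Local Open Scope ring_scope.

Section Polytopes.
Variables (R : realType) (m : nat).
Implicit Types (P S : set 'rV[R]_m) (v : 'rV[R]_m).

Definition convex_hull S : set 'rV[R]_m := smallest (@convex_set R 'rV[R]_m) S.

Definition polytope P : Prop :=
  exists2 S : set 'rV[R]_m, finite_set S & P = convex_hull S.

(* The vertices of a polytope are its extreme points. *)
Definition vertex P v : Prop :=
  P v /\ forall (x y : 'rV[R]_m) (t : R),
    P x -> P y -> 0 < t < 1 -> v = t *: x + (1 - t) *: y -> x = v /\ y = v.

Definition lattice : set 'rV[R]_m :=
  [set v | forall j, exists k : int, v ord0 j = k%:~R].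

Definition lattice_polytope P : Prop :=
  polytope P /\ forall v, vertex P v -> lattice v.

(* [P] has dimension [d]: [U] is the smallest linear subspace containing all
   differences of points of [P], i.e. the direction of the affine hull. *)
Definition has_dimension P (d : nat) : Prop :=
  P !=set0 /\ exists U : {vspace 'rV[R]_m},
    [/\ forall x y, P x -> P y -> x - y \in U,
        forall W : {vspace 'rV[R]_m},
          (forall x y, P x -> P y -> x - y \in W) -> (U <= W)%VS
      & \dim U = d].

Definition dilate (n : nat) P : set 'rV[R]_m := [set n%:R *: x | x in P].

Definition lattice_count P : nat := #|` fset_set (P `&` lattice)|.

(* Such a polynomial is unique, and has rational coefficients; it is taken in
   R[i] so that its complex roots are roots in the sense of the library. *)
Definition is_ehrhart_poly P (p : {poly R[i]}) : Prop :=
  forall n : nat, p.[n%:R] = (lattice_count (dilate n P))%:R.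

End Polytopes.

(* Main.v *)
Require Import Defs.
From mathcomp Require Import all_boot all_order all_algebra.
From mathcomp Require Import finmap boolp classical_sets cardinality reals.
From mathcomp Require Import interval_inference convex complex.
From mathcomp Require Import ring lra zify.

(* Take coordinates in which [y] ranges over [0, p] on [P], with [p] the lattice
   width of [P]. The left and right boundaries of [P] only bend at lattice
   points, so counting the lattice points of [n P] row by row gives exactly
   [A n^2 + b n + 1]. Here [A] is the trapezoidal sum of the row lengths, and
   [b = s / 2 + p - sigma], where [s] is the total length of the bottom and top
   edges and [sigma] sums the fractional parts of the ends of the integral rows
   below the top one. Along a lattice segment fractional parts pair off under a
   point reflection, so [sigma <= p - 1], and [1 < b <= s / 2 + p].
   Convexity gives [A >= p s / 2]; minimality of [p], together with a shear
   which puts the top and bottom edges above one another, gives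
   [A >= p (p + s) / 4]. These bounds yield Scott's inequality: with
   [i = A - b + 1] interior and [2 b] boundary points, either [i = 0], or
   [2 b <= A + 4], or [A = b = 9 / 2]. Solving the quadratic equation in each of
   the three cases locates the roots. *)

Set Implicit Arguments.
Unset Strict Implicit.
Unset Printing Implicit Defensive.

Import Order.TTheory GRing.Theory Num.Theory.

Local Open Scope classical_set_scope.
Local Open Scope ring_scope.

(** * Floor sums along a rational slope *)

Section FloorSums.
Variable R : realType.
Implicit Types (d : int) (D n : nat).

Definition fracr (x : R) : R := x - (Num.floor x)%:~R.

Lemma fracr_ge0 (x : R) : 0 <= fracr x.
Proof. by rewrite /fracr subr_ge0 floor_le. Qed.

Lemma fracr_int (m : int) : fracr m%:~R = 0.
Proof. by rewrite /fracr intrKfloor subrr. Qed.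

(** The left side is an integer, and it is less than 2. *)
Lemma fracrN_le1 (m : int) (x : R) : fracr x + fracr (m%:~R - x) <= 1.
Proof.
rewrite /fracr.
have h1 := floorD1_gt x; have h2 := floorD1_gt (m%:~R - x).
have : (m < (Num.floor x + 1) + (Num.floor (m%:~R - x) + 1))%R.
  by rewrite -(ltr_int R) intrD; lra.
move=> h.
have h' : m + 1 - 2 <= Num.floor x + Num.floor (m%:~R - x) by lia.
have := h'; rewrite -(ler_int R) !intrD intrN; lra.
Qed.

Lemma sum_natr n : \sum_(0 <= i < n) i%:R = n%:R * (n%:R - 1) / 2 :> R.
Proof.
elim: n => [|n IH]; first by rewrite big_nil !mul0r.
by rewrite big_nat_recr //= IH -[n.+1]addn1 natrD; field.
Qed.

(** The term at 0 vanishes. The reflection [i -> D - i] pairs the other [D - 1] terms, and each pair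
    has sum at most 1. *)
Lemma sum_fracr_le d D : (0 < D)%N ->
  2 * \sum_(0 <= i < D) fracr (d%:~R * i%:R / D%:R) <= D%:R - 1.
Proof.
case: D => // D _.
have D0 : D.+1%:R != 0 :> R by rewrite pnatr_eq0.
rewrite big_nat_recl //= mulr0 mul0r -[0]/(0%:~R) fracr_int add0r.
rewrite mulr2n mulrDl mul1r {1}big_nat_rev /= -big_split /= big_nat.
apply: le_trans (_ : \sum_(0 <= i < D) 1 <= _); last first.
  by rewrite big_const_nat subn0 iter_addr_0 -[D.+1]addn1 natrD addrK.
rewrite [leRHS]big_nat; apply: ler_sum => i /andP[_ iD].
rewrite add0n.
have -> : d%:~R * (D - i.+1).+1%:R / D.+1%:R =
          d%:~R - d%:~R * i.+1%:R / D.+1%:R :> R.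
  rewrite subnSK // natrB ?(ltnW iD) //.
  have -> : D%:R = D.+1%:R - 1 :> R by rewrite -[D.+1]addn1 natrD addrK.
  rewrite -[i.+1]addn1 natrD.
  by move: (D.+1%:R) D0 => e e0; field.
by rewrite addrC fracrN_le1.
Qed.

(** Advancing [i] by [D] adds the integer [d], so the fractional parts are periodic; [s] is their
    sum over one period. *)
Lemma floor_sum_ratio d D : (0 < D)%N ->
  exists s : R, [/\ 0 <= s, 2 * s <= D%:R - 1 &
    forall n, \sum_(0 <= i < n * D) (Num.floor (d%:~R * i%:R / D%:R : R))%:~R
      = n%:R ^+ 2 * (D%:R * d%:~R / 2) - n%:R * (d%:~R / 2) - n%:R * s :> R].
Proof.
move=> D0; have D0' : D%:R != 0 :> R by rewrite pnatr_eq0 -lt0n.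
exists (\sum_(0 <= i < D) fracr (d%:~R * i%:R / D%:R)); split.
- by apply: sumr_ge0 => i _; exact: fracr_ge0.
- exact: sum_fracr_le.
elim=> [|n IH]; first by rewrite mul0n big_nil expr0n /= !mul0r !subr0.
rewrite mulSnr (@big_cat_nat _ _ _ (n * D)) ?leq_addr //= IH.
rewrite -{1}[(n * D)%N]add0n big_addn addKn.
have -> : \sum_(0 <= i < D) (Num.floor (d%:~R * (i + n * D)%:R / D%:R : R))%:~R
  = \sum_(0 <= i < D) (n%:R * d%:~R + (d%:~R / D%:R) * i%:R)
    - \sum_(0 <= i < D) fracr (d%:~R * i%:R / D%:R) :> R.
  rewrite -sumrB; apply: eq_bigr => i _.
  have -> : d%:~R * (i + n * D)%:R / D%:R
          = d%:~R * i%:R / D%:R + (n%:Z * d)%:~R :> R.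
    by rewrite natrD natrM intrM; field.
  rewrite floorDrz ?intr_int // intrKfloor intrD intrM /fracr; field.
  by [].
move: (\sum_(0 <= i < D) fracr _) => s.
rewrite big_split /= big_const_nat subn0 iter_addr_0 -mulr_sumr sum_natr.
by rewrite -[n.+1]addn1 natrD -mulr_natr; field.
Qed.

End FloorSums.

(** * Planar lattice bodies and their right boundary *)

Section LatticeBody.
Variable R : realType.
Implicit Types K : R -> R -> Prop.

(** Planar sets are relations between two real coordinates, so that a change of coordinates is a
    substitution. *)
Definition convex_body K := forall x y x' y' t : R,
  0 <= t <= 1 -> K x y -> K x' y' ->
  K (t * x + (1 - t) * x') (t * y + (1 - t) * y').

(** Stands for having lattice vertices: the first form may be maximal along a whole edge, and the
    second, independent form then selects an end of it. *)
Definition lattice_lex_max K := forall a b c d : R, a * d - b * c != 0 ->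
  exists m k : int, K m%:~R k%:~R /\ forall x y, K x y ->
    a * x + b * y < a * m%:~R + b * k%:~R \/
    a * x + b * y = a * m%:~R + b * k%:~R /\
    c * x + d * y <= c * m%:~R + d * k%:~R.

Definition lattice_body K := convex_body K /\ lattice_lex_max K.

Definition rightmost K (y x : R) := K x y /\ forall x', K x' y -> x' <= x.

Definition right_end K (y : R) : R := sup [set x | K x y].

Lemma rightmost_end K y x : rightmost K y x -> right_end K y = x.
Proof.
move=> [Kx xmax]; apply/eqP; rewrite eq_le; apply/andP; split.
  by apply: ge_sup => [|x' /xmax //]; exists x.
by apply: ub_le_sup => //; exists x => x' /xmax.
Qed.

(* Trapezoidal rule with unit steps; it is exact when the boundary only bends at
   lattice points. *)
Definition right_area K (y0 y1 : nat) : R :=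
  \sum_(y0 <= j < y1) (right_end K j%:R + right_end K j.+1%:R) / 2.

(** Row [j] of the [n]-th dilate is the row of [K] at height [j / n]. The top row is left out, so
    that sums over adjacent strips add up. *)
Definition right_floor_sum K (n y0 y1 : nat) : R :=
  \sum_(n * y0 <= j < n * y1)
    (Num.floor (n%:R * right_end K (j%:R / n%:R)))%:~R.

Lemma convex_body_between K y0 y1 x0 x1 y : convex_body K ->
  y0 < y1 -> y0 <= y <= y1 -> K x0 y0 -> K x1 y1 ->
  K (x0 + (x1 - x0) * ((y - y0) / (y1 - y0))) y.
Proof.
move=> cK y01 /andP[y0y yy1] K0 K1.
have d0 : 0 < y1 - y0 by rewrite subr_gt0.
have t01 : 0 <= (y - y0) / (y1 - y0) <= 1.
  apply/andP; split; first by apply: divr_ge0; lra.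
  by rewrite ler_pdivrMr // mul1r; lra.
have := cK _ _ _ _ _ t01 K1 K0.
congr (K _ _); first by ring.
by field; rewrite gt_eqF.
Qed.

(** Bounds all of [K], not just the strip between the ends of the chord; two opposite bounds of this
    kind later force [K] into a line. *)
Definition left_of_chord K (D y0 : nat) (x0 x1 : int) :=
  forall x y, K x y ->
    D%:R * x <= D%:R * x0%:~R + (x1%:~R - x0%:~R) * (y - y0%:R).

Lemma right_end_chord K D y0 x0 x1 : convex_body K -> (0 < D)%N ->
  K x0%:~R y0%:R -> K x1%:~R (y0 + D)%:R -> left_of_chord K D y0 x0 x1 ->
  forall y : R, y0%:R <= y <= (y0 + D)%:R ->
  rightmost K y (x0%:~R + (x1%:~R - x0%:~R) * ((y - y0%:R) / D%:R)).
Proof.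
move=> cK D0 K0 K1 chK y yb.
have D0' : 0 < D%:R :> R by rewrite ltr0n.
have eD : (y0 + D)%:R - y0%:R = D%:R :> R by rewrite natrD; ring.
split.
  rewrite -eD; apply: convex_body_between => //.
  by rewrite -subr_gt0 eD.
move=> x' /chK h; rewrite -(ler_pM2l D0'); apply: le_trans h _.
rewrite le_eqVlt; apply/orP; left; apply/eqP; field.
by rewrite gt_eqF.
Qed.

(* [s] collects the fractional parts cut off along the boundary at [n = 1]. *)
Lemma right_chain K : lattice_body K -> forall (D y0 : nat) (x0 x1 : int),
  (0 < D)%N -> rightmost K y0%:R x0%:~R -> rightmost K (y0 + D)%:R x1%:~R ->
  (forall y : R, y0%:R <= y <= (y0 + D)%:R -> exists x, rightmost K y x) /\
  exists s : R, [/\ 0 <= s, 2 * s <= D%:R - 1,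
    2 * s <= D%:R - 2 \/ left_of_chord K D y0 x0 x1 &
    forall n, (0 < n)%N -> right_floor_sum K n y0 (y0 + D) =
      n%:R ^+ 2 * right_area K y0 (y0 + D)
      - n%:R * ((x1%:~R - x0%:~R) / 2) - n%:R * s].
Proof.
move=> [cK lK]; elim/ltn_ind => D IH y0 x0 x1 D0 r0 r1.
have D0' : 0 < D%:R :> R by rewrite ltr0n.
have [K0 _] := r0; have [K1 _] := r1.
(* The first form is normal to the chord. Either its maximum is on the chord, which is then the
   boundary, or it is attained at a lattice point beyond, where the chain is split. *)
have [|m [k [Kmk mkmax]]] := lK D%:R (x0%:~R - x1%:~R) 0 1.
  by rewrite mulr1 mulr0 subr0 gt_eqF.
have mk_max x y : K x y -> D%:R * x + (x0%:~R - x1%:~R) * y <=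
    D%:R * m%:~R + (x0%:~R - x1%:~R) * k%:~R.
  by move=> /mkmax[/ltW//|[-> _]].
have [le_mk|gt_mk] := leP (D%:R * m%:~R + (x0%:~R - x1%:~R) * k%:~R)
                     (D%:R * x0%:~R + (x0%:~R - x1%:~R) * y0%:R : R).
- have chK : left_of_chord K D y0 x0 x1.
    by move=> x y /mk_max h; lra.
  have rK := right_end_chord cK D0 K0 K1 chK.
  split; first by move=> y /rK ?; eexists; eassumption.
  have [s [s0 sD sE]] := @floor_sum_ratio R (x1 - x0) D D0.
  exists s; split=> //; first by right.
  move=> n n0; have n0' : n%:R != 0 :> R by rewrite pnatr_eq0 -lt0n.
  have n0'' : 0 < n%:R :> R by rewrite ltr0n.
  have Dn0 : D%:R != 0 :> R by rewrite gt_eqF.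
  have -> : right_area K y0 (y0 + D) = D%:R * (x0%:~R + x1%:~R) / 2.
    rewrite /right_area -{1}[y0]add0n big_addn addKn.
    under eq_big_nat => i /andP[_ iD].
      rewrite (rightmost_end (rK _ _)); last by rewrite !ler_nat; lia.
      rewrite (rightmost_end (rK _ _)); last by rewrite !ler_nat; lia.
      rewrite (_ : _ / 2 = (x0%:~R + (x1%:~R - x0%:~R) / (2 * D%:R)) +
              (x1%:~R - x0%:~R) / D%:R * i%:R); last first.
        by rewrite -addSn !natrD -[i.+1]addn1 natrD; field.
      over.
    rewrite big_split /= big_const_nat subn0 iter_addr_0 -mulr_sumr sum_natr.
    by rewrite -mulr_natr; field.
  rewrite /right_floor_sum mulnDr -{1}[(n * y0)%N]add0n big_addn addKn.
  rewrite (eq_big_nat _ _ (F2 := fun i => (n%:Z * x0)%:~R +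
     (Num.floor ((x1 - x0)%:~R * i%:R / D%:R : R))%:~R)); last first.
    move=> i /andP[_ iD].
    rewrite (rightmost_end (rK _ _)); last first.
      rewrite ler_pdivlMr // ler_pdivrMr // -!natrM !ler_nat; lia.
    rewrite [X in Num.floor X](_ : _ =
      (x1 - x0)%:~R * i%:R / D%:R + (n%:Z * x0)%:~R).
      by rewrite floorDrz ?intr_int // intrKfloor addrC [LHS]intrD.
    by rewrite intrM intrB natrD natrM; field; apply/andP.
  rewrite big_split /= sE big_const_nat subn0 iter_addr_0 -[_ *+ (n * D)]mulr_natr.
  by rewrite natrM intrM intrB; field.
(* The splitting point lies strictly between the two heights: otherwise convexity would give a point
   of [K] to the right of one of the given ends. *)
- have lb : y0%:R < k%:~R :> R.
    rewrite ltNge; apply/negP => ky.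
    have kD : k%:~R < (y0 + D)%:R :> R by rewrite natrD; lra.
    have yb : (k%:~R <= y0%:R :> R) && (y0%:R <= (y0 + D)%:R :> R).
      by apply/andP; split; rewrite ?natrD; lra.
    have := convex_body_between cK kD yb Kmk K1; case: r0 => _ h /h.
    have e0 : 0 < (y0 + D)%:R - k%:~R :> R by lra.
    rewrite -(ler_pM2r e0) mulrDl -mulrA divfK ?gt_eqF // natrD; nra.
  have ub : k%:~R < (y0 + D)%:R :> R.
    rewrite ltNge; apply/negP => ky.
    have kD : y0%:R < k%:~R :> R by [].
    have yb : (y0%:R <= (y0 + D)%:R :> R) && ((y0 + D)%:R <= k%:~R :> R).
      by apply/andP; split; rewrite ?natrD; lra.
    have := convex_body_between cK kD yb K0 Kmk; case: r1 => _ h /h.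
    have e0 : 0 < k%:~R - y0%:R :> R by lra.
    rewrite -(ler_pM2r e0) mulrDl -mulrA divfK ?gt_eqF // natrD.
    move: ky; rewrite natrD; nra.
  have {lb ub mkmax} [D1 [D1_gt0 D1D kE]] : exists D1 : nat,
      [/\ (0 < D1)%N, (D1 < D)%N & k = (y0 + D1)%:Z].
    move: lb ub; rewrite !pmulrn !ltr_int => lb ub.
    exists `|k - y0|%N; split; lia.
  have {Kmk} rk : rightmost K (y0 + D1)%:R m%:~R.
    rewrite pmulrn -kE; split=> // x' /mk_max.
    by rewrite lerD2r ler_pM2l.
  have D2_gt0 : (0 < D - D1)%N by rewrite subn_gt0.
  have eD : (y0 + D1 + (D - D1) = y0 + D)%N by lia.
  have r1' : rightmost K (y0 + D1 + (D - D1))%:R x1%:~R by rewrite eD.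
  have [ex1 [s1 [s10 s1D _ s1E]]] := IH D1 D1D _ _ _ D1_gt0 r0 rk.
  have [|ex2 [s2 [s20 s2D _ s2E]]] := IH (D - D1)%N _ _ _ _ D2_gt0 rk r1'.
    by rewrite ltn_subrL D1_gt0.
  rewrite eD in ex2 s2E; rewrite natrB ?(ltnW D1D) // in s2D.
  split.
    move=> y /andP[yl yu]; have [h|h] := leP y (y0 + D1)%:R.
      by apply: ex1; rewrite yl.
    by apply: ex2; rewrite yu ltW.
  (* The two bounds add up to [(D1 - 1) + (D - D1 - 1) = D - 2]: a genuine break gains 1. *)
  exists (s1 + s2); split; [lra|lra|left; lra|].
  move=> n n0.
  have le1 : (y0 <= y0 + D1)%N by exact: leq_addr.
  have le2 : (y0 + D1 <= y0 + D)%N by rewrite leq_add2l ltnW.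
  have -> : right_area K y0 (y0 + D) =
            right_area K y0 (y0 + D1) + right_area K (y0 + D1) (y0 + D).
    by rewrite /right_area (big_cat_nat le1 le2).
  have -> : right_floor_sum K n y0 (y0 + D) =
       right_floor_sum K n y0 (y0 + D1) + right_floor_sum K n (y0 + D1) (y0 + D).
    by rewrite /right_floor_sum (@big_cat_nat _ _ _ (n * (y0 + D1))) //= leq_mul.
  by rewrite s1E // s2E //; field.
Qed.

End LatticeBody.

(** * Unimodular coordinates and counting by rows *)

Section LatticePointCount.
Variable R : realType.
Implicit Types K : R -> R -> Prop.

Definition affine_pullback K (x0 y0 a b c d : int) : R -> R -> Prop :=
  fun x y => K (x0%:~R + a%:~R * x + b%:~R * y) (y0%:~R + c%:~R * x + d%:~R * y).

(** The determinant has the integer inverse [e], so the inverse matrix is integral and carries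
    lattice points back. Linear forms are multiplied by that inverse. *)
Lemma lattice_body_affine K (x0 y0 a b c d e : int) :
  (a * d - b * c) * e = 1 -> lattice_body K ->
  lattice_body (affine_pullback K x0 y0 a b c d).
Proof.
move=> det1 [cK lK].
have detR : (a%:~R * d%:~R - b%:~R * c%:~R) * e%:~R = 1 :> R.
  by rewrite -!intrM -intrB -intrM det1.
split.
  move=> x y x' y' t t01 h h'; rewrite /affine_pullback.
  by have := cK _ _ _ _ _ t01 h h'; congr (K _ _); ring.
move=> f g h k fg0.
have [|M [N [KMN MNmax]]] := lK
    (e%:~R * (f * d%:~R - g * c%:~R)) (e%:~R * (g * a%:~R - f * b%:~R))
    (e%:~R * (h * d%:~R - k * c%:~R)) (e%:~R * (k * a%:~R - h * b%:~R)).
  rewrite (_ : _ - _ = (f * k - g * h) *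
    ((a%:~R * d%:~R - b%:~R * c%:~R) * e%:~R) * e%:~R); last by ring.
  rewrite detR mulr1 mulf_neq0 //; apply/eqP => e0.
  by move/eqP: detR; rewrite e0 mulr0 eq_sym oner_eq0.
exists (e * (d * (M - x0) - b * (N - y0))), (e * (a * (N - y0) - c * (M - x0))).
have fE (f' g' x y : R) : f' * x + g' * y =
  e%:~R * (f' * d%:~R - g' * c%:~R) * (x0%:~R + a%:~R * x + b%:~R * y) +
  e%:~R * (g' * a%:~R - f' * b%:~R) * (y0%:~R + c%:~R * x + d%:~R * y) -
  (e%:~R * (f' * d%:~R - g' * c%:~R) * x0%:~R +
   e%:~R * (g' * a%:~R - f' * b%:~R) * y0%:~R).
  rewrite (_ : f' * x + g' * y = (f' * x + g' * y) *
    ((a%:~R * d%:~R - b%:~R * c%:~R) * e%:~R)); first by ring.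
  by rewrite detR mulr1.
set m : R := (e * (d * (M - x0) - b * (N - y0)))%:~R.
set n : R := (e * (a * (N - y0) - c * (M - x0)))%:~R.
have eM : x0%:~R + a%:~R * m + b%:~R * n = M%:~R.
  rewrite /m /n !(intrM, intrB).
  rewrite [LHS](_ : _ = x0%:~R + (M%:~R - x0%:~R) *
    ((a%:~R * d%:~R - b%:~R * c%:~R) * e%:~R)); last by ring.
  by rewrite detR mulr1; ring.
have eN : y0%:~R + c%:~R * m + d%:~R * n = N%:~R.
  rewrite /m /n !(intrM, intrB).
  rewrite [LHS](_ : _ = y0%:~R + (N%:~R - y0%:~R) *
    ((a%:~R * d%:~R - b%:~R * c%:~R) * e%:~R)); last by ring.
  by rewrite detR mulr1; ring.
split; first by rewrite /affine_pullback eM eN.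
move=> x y /MNmax; rewrite (fE f g x) (fE f g m) (fE h k x) (fE h k m) eM eN.
rewrite ltrD2r lerD2r => -[?|[-> ?]]; [by left|by right].
Qed.

(** Lists the lattice points of the [n]-th dilate, by scaling them back into [K]. *)
Definition lattice_points K (n : nat) (s : seq (int * int)) :=
  uniq s /\ forall m k : int,
    (m, k) \in s <-> K (m%:~R / n%:R) (k%:~R / n%:R).

Lemma lattice_points_affine K (x0 y0 a b c d e : int) n s : (0 < n)%N ->
  (a * d - b * c) * e = 1 -> lattice_points (affine_pullback K x0 y0 a b c d) n s ->
  exists s', lattice_points K n s' /\ size s' = size s.
Proof.
move=> n0 det1 [us sP].
pose F (z : int * int) : int * int :=
  (n%:Z * x0 + a * z.1 + b * z.2, n%:Z * y0 + c * z.1 + d * z.2).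
pose G (z : int * int) : int * int :=
  (e * (d * (z.1 - n%:Z * x0) - b * (z.2 - n%:Z * y0)),
   e * (a * (z.2 - n%:Z * y0) - c * (z.1 - n%:Z * x0))).
have FK : cancel F G.
  move=> [x y]; rewrite /F /G /=; congr (_, _).
    rewrite -[RHS]mulr1 -det1; ring.
  rewrite -[RHS]mulr1 -det1; ring.
have GK : cancel G F.
  move=> [x y]; rewrite /F /G /=; congr (_, _).
    rewrite [RHS](_ : x = n%:Z * x0 + (x - n%:Z * x0) * 1); last by ring.
    rewrite -det1; ring.
  rewrite [RHS](_ : y = n%:Z * y0 + (y - n%:Z * y0) * 1); last by ring.
  rewrite -det1; ring.
exists (map F s); split; last by rewrite size_map.
split; first by rewrite map_inj_uniq //; exact: can_inj FK.
move=> m k; rewrite -[(m, k)]GK (mem_map (can_inj FK)).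
have n0' : n%:R != 0 :> R by rewrite pnatr_eq0 -lt0n.
have FE (z : int * int) : K ((F z).1%:~R / n%:R) ((F z).2%:~R / n%:R) =
    affine_pullback K x0 y0 a b c d (z.1%:~R / n%:R) (z.2%:~R / n%:R).
  by rewrite /affine_pullback /F /=; congr (K _ _); rewrite !(intrD, intrM); field.
by have := FE (G (m, k)); rewrite GK /= => ->; exact: sP.
Qed.

(** Turns the left boundary into a right boundary, with the sign of the abscissa changed. *)
Definition mirror K : R -> R -> Prop := affine_pullback K 0 0 (-1) 0 0 1.

Lemma mirrorE K x y : mirror K x y = K (- x) y.
Proof. by rewrite /mirror /affine_pullback; congr (K _ _); ring. Qed.

Lemma lattice_body_mirror K : lattice_body K -> lattice_body (mirror K).
Proof. exact: (@lattice_body_affine _ _ _ _ _ _ _ (-1)). Qed.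

Lemma mem_row K y x0 x1 x : convex_body K -> rightmost K y x1 ->
  rightmost (mirror K) y x0 -> K x y <-> - x0 <= x <= x1.
Proof.
move=> cK [K1 max1] [K0 max0]; split=> [Kx|/andP[x0x xx1]].
  rewrite (max1 _ Kx) andbT lerNl; apply: max0.
  by rewrite mirrorE opprK.
rewrite mirrorE in K0.
have [e|ne] := eqVneq (x1 + x0) 0.
  by rewrite (_ : x = x1) //; lra.
have d0 : 0 < x1 + x0 by rewrite lt_neqAle eq_sym ne; lra.
have t01 : 0 <= (x + x0) / (x1 + x0) <= 1.
  apply/andP; split; first by apply: divr_ge0; lra.
  by rewrite ler_pdivrMr // mul1r; lra.
have := cK _ _ _ _ _ t01 K1 K0; congr (K _ _); last by ring.
by field.
Qed.

(** The ceiling of the left end is minus the floor of its opposite. A nonempty row without lattice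
    points gets the value 0, never a negative one. *)
Definition row_size K (n j : nat) : int :=
  Num.floor (n%:R * right_end K (j%:R / n%:R) : R) +
  Num.floor (n%:R * right_end (mirror K) (j%:R / n%:R) : R) + 1.

Lemma lattice_points_rows K (p n : nat) : convex_body K -> (0 < n)%N ->
  (forall x y : R, K x y -> 0 <= y <= p%:R) ->
  (forall y : R, 0 <= y <= p%:R -> exists x, rightmost K y x) ->
  (forall y : R, 0 <= y <= p%:R -> exists x, rightmost (mirror K) y x) ->
  exists s, lattice_points K n s /\
    (size s)%:R = \sum_(0 <= j < (n * p).+1) (row_size K n j)%:~R :> R.
Proof.
move=> cK n0 Kp exr exl.
have n0' : 0 < n%:R :> R by rewrite ltr0n.
pose lo j : int := - Num.floor (n%:R * right_end (mirror K) (j%:R / n%:R) : R).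
have jp j : (j < (n * p).+1)%N -> 0 <= (j%:R / n%:R : R) <= p%:R.
  move=> jnp; rewrite divr_ge0 ?ler0n //= ler_pdivrMr // -natrM ler_nat; lia.
have rowP j (m : int) : (j < (n * p).+1)%N ->
    K (m%:~R / n%:R) (j%:R / n%:R) <-> lo j <= m < lo j + row_size K n j.
  move=> /jp jb; have [x1 r1] := exr _ jb; have [x0 r0] := exl _ jb.
  rewrite (mem_row _ cK r1 r0) /lo /row_size (rightmost_end r1) (rightmost_end r0).
  have -> : (m%:~R / n%:R <= x1) = (m <= Num.floor (n%:R * x1)).
    by rewrite floor_ge_int ler_pdivrMr // mulrC.
  have -> : (- x0 <= m%:~R / n%:R) = (- m <= Num.floor (n%:R * x0)).
    by rewrite floor_ge_int intrN ler_pdivlMr // mulNr lerNl mulrC.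
  by split; lia.
have row_ge0 j : (j < (n * p).+1)%N -> 0 <= row_size K n j.
  move=> /jp jb; have [x1 r1] := exr _ jb; have [x0 r0] := exl _ jb.
  rewrite /row_size (rightmost_end r1) (rightmost_end r0).
  have [/(mem_row _ cK r1 r0) x01 _] := r1.
  have h1 := floorD1_gt (n%:R * x1); have h0 := floorD1_gt (n%:R * x0).
  have : (0 < (Num.floor (n%:R * x1) + 1) + (Num.floor (n%:R * x0) + 1))%R.
    rewrite -(ltr_int R) intrD; apply: le_lt_trans (ltrD h1 h0).
    by rewrite -mulrDr mulr_ge0 ?ler0n //; lra.
  lia.
exists [seq (lo j + i%:Z, j%:Z) | j <- iota 0 (n * p).+1,
                                 i <- iota 0 `|row_size K n j|%N]; split.
  split.
    apply: allpairs_uniq_dep; first exact: iota_uniq.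
      by move=> *; exact: iota_uniq.
    move=> [j i] [j' i'] _ _ /= [e [ej]].
    by rewrite ej in e *; move: e => /addrI[->].
  move=> m k; split.
    move=> /allpairsPdep[j [i [hj hi [-> ->]]]].
    move: hj hi; rewrite !mem_iota !add0n /= => hj hi.
    by apply/(rowP j (lo j + i%:Z) hj); have := row_ge0 j hj; lia.
  move=> Kmk; have /andP[k0 kp] := Kp _ _ Kmk.
  rewrite ler_pdivlMr // mul0r ler0z in k0.
  case: k k0 kp Kmk => // k _; rewrite ler_pdivrMr // -natrM -pmulrn ler_nat => kp.
  have kp' : (k < (n * p).+1)%N by rewrite ltnS mulnC.
  move=> /(rowP _ _ kp') /andP[h1 h2]; apply/allpairsPdep.
  exists k, `|m - lo k|%N; rewrite !mem_iota !add0n; split=> //=; first lia.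
  congr (_, _); lia.
rewrite size_allpairs_dep sumnE big_map -[iota 0 _]/(index_iota 0 (n * p).+1).
rewrite natr_sum big_nat [RHS]big_nat; apply: eq_bigr => j /andP[_ hj].
by rewrite size_iota pmulrn gez0_abs // row_ge0.
Qed.

End LatticePointCount.

(** * Bounds on the coefficients of the counting polynomial *)

Section EhrhartCoefficients.
Variable R : realType.
Implicit Types K : R -> R -> Prop.

(** The chord lies in [K], so each right end is at or beyond it. *)
Lemma right_area_ge_segment K (D y0 : nat) (x0 x1 : R) : convex_body K ->
  (forall y : R, y0%:R <= y <= (y0 + D)%:R -> exists x, rightmost K y x) ->
  K x0 y0%:R -> K x1 (y0 + D)%:R ->
  D%:R * (x0 + x1) / 2 <= right_area K y0 (y0 + D).
Proof.
move=> cK exr K0 K1; case: (posnP D) => [->|D0].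
  by rewrite addn0 /right_area big_geq // !mul0r.
have D0' : 0 < D%:R :> R by rewrite ltr0n.
have Dn0 : D%:R != 0 :> R by rewrite gt_eqF.
have eD : (y0 + D)%:R - y0%:R = D%:R :> R by rewrite natrD; ring.
have re i : (i <= D)%N ->
    x0 + (x1 - x0) / D%:R * i%:R <= right_end K (i + y0)%:R.
  move=> iD.
  have yb : (y0%:R <= (i + y0)%:R :> R) && ((i + y0)%:R <= (y0 + D)%:R :> R).
    by rewrite !ler_nat; lia.
  have [x rx] := exr _ yb; rewrite (rightmost_end rx); case: rx => _; apply.
  have y01 : y0%:R < (y0 + D)%:R :> R by rewrite -subr_gt0 eD.
  have := convex_body_between cK y01 yb K0 K1.
  by congr (K _ _); rewrite eD natrD; field.
rewrite /right_area -{1}[y0]add0n big_addn addKn.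
apply: le_trans (_ : \sum_(0 <= i < D) ((x0 + (x1 - x0) / (2 * D%:R)) +
              (x1 - x0) / D%:R * i%:R) <= _).
  rewrite big_split /= big_const_nat subn0 iter_addr_0 -mulr_sumr sum_natr.
  rewrite -[_ *+ D]mulr_natr le_eqVlt; apply/orP; left; apply/eqP.
  by field.
apply: ler_sum_nat => i /andP[_ iD].
have h1 := re i (ltnW iD); have h2 := re i.+1 iD.
rewrite addSn -[i.+1]addn1 natrD in h2 *.
rewrite (_ : _ + _ = (x0 + (x1 - x0) / D%:R * i%:R +
  (x0 + (x1 - x0) / D%:R * (i%:R + 1))) / 2); last by field.
by rewrite ler_pM2r ?invr_gt0 // lerD.
Qed.

(** Adds the chord bounds below and above the point [(w1, w2)]. *)
Lemma right_area_ge_through K (p w2 : nat) (x0 x1 w1 : R) : convex_body K ->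
  (forall y : R, 0 <= y <= p%:R -> exists x, rightmost K y x) ->
  (w2 <= p)%N -> K x0 0 -> K w1 w2%:R -> K x1 p%:R ->
  (p%:R * w1 + w2%:R * x0 + (p%:R - w2%:R) * x1) / 2 <= right_area K 0 p.
Proof.
move=> cK exr w2p K0 Kw K1.
have e : (w2 + (p - w2) = p)%N by rewrite subnKC.
have h1 : w2%:R * (x0 + w1) / 2 <= right_area K 0 (0 + w2).
  apply: right_area_ge_segment => // y /andP[y0 yw]; apply: exr.
  by rewrite y0 (le_trans yw) // ler_nat.
have h2 : (p - w2)%:R * (w1 + x1) / 2 <= right_area K w2 (w2 + (p - w2)).
  apply: right_area_ge_segment; rewrite ?e // => y /andP[y0 yw]; apply: exr.
  by rewrite yw andbT (le_trans _ y0) // ler0n.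
rewrite add0n e natrB // in h1 h2.
rewrite /right_area (big_cat_nat (leq0n w2) w2p) /=.
by move: h1 h2; rewrite /right_area; lra.
Qed.

(* The shear by [k] brings the top and bottom edges above one another, up to
   half of what their lengths leave of [p]. *)
Lemma centering_shear (p : nat) (s c : R) : (0 < p)%N -> 0 <= s <= p%:R ->
  exists (k : int) (v : R), c - s / 2 <= v - k%:~R * p%:R <= c + s / 2 /\
    `|v| <= (p%:R - s) / 2.
Proof.
move=> p0 /andP[s0 sp]; have p0' : 0 < p%:R :> R by rewrite ltr0n.
have := floor_itv (c / p%:R + 2^-1).
set k := Num.floor _; rewrite intrD => /andP[k1 k2].
have k1' : k%:~R * p%:R <= c + p%:R / 2.
  by have := ler_wpM2r (ltW p0') k1; rewrite [leRHS]mulrDl divfK ?gt_eqF //; lra.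
have k2' : c + p%:R / 2 < k%:~R * p%:R + p%:R.
  move: k2; rewrite -(ltr_pM2r p0') [ltLHS]mulrDl divfK ?gt_eqF //; lra.
(* The residue [c - k p] is within [p / 2] of 0. Moving it towards 0 by up to [s / 2] leaves at most
   [(p - s) / 2]. *)
exists (- k).
have [h1|h1] := leP (s / 2) (c - k%:~R * p%:R).
  by exists (c - k%:~R * p%:R - s / 2); rewrite intrN ler_norml; lra.
have [h2|h2] := leP (c - k%:~R * p%:R) (- (s / 2)).
  by exists (c - k%:~R * p%:R + s / 2); rewrite intrN ler_norml; lra.
by exists 0; rewrite intrN ler_norml; lra.
Qed.

(** Here [p] is the width and [s] the total length of the two horizontal edges. In width 1 the two
    edges determine [A]. *)
Definition ehrhart_bounds (p : nat) (A b s : R) :=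
  [/\ 0 <= s, 1 < b, s / 2 + 1 <= b <= s / 2 + p%:R,
      p%:R * s / 2 <= A /\ p%:R * (p%:R + s) / 4 <= A & p = 1%N -> A = s / 2].

(** The last hypothesis bounds from below the width in each direction [x + k y], which is what the
    area estimate after a shear calls for. *)
Lemma lattice_body_count K (p : nat) : lattice_body K -> (0 < p)%N ->
  (forall x y, K x y -> 0 <= y <= p%:R) ->
  (exists x, K x 0) -> (exists x, K x p%:R) ->
  (forall a c e, (forall x y, K x y -> a * x + c * y = e) -> a = 0) ->
  (forall k : int, exists w1 w2 u1 u2 : int,
    [/\ K w1%:~R w2%:~R, K u1%:~R u2%:~R &
        p%:Z <= (w1 + k * w2) - (u1 + k * u2)]) ->
  exists A b s : R, ehrhart_bounds p A b s /\
    forall n, (0 < n)%N -> exists t, lattice_points K n t /\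
      (size t)%:R = A * n%:R ^+ 2 + b * n%:R + 1.
Proof.
move=> bK p0 Kp [x0' Kx0'] [x1' Kx1'] nline width.
have p0' : 0 < p%:R :> R by rewrite ltr0n.
have [cK _] := bK; have bM := lattice_body_mirror bK; have [cM _] := bM.
have bottom (L : R -> R -> Prop) : lattice_body L ->
    (forall x y, L x y -> 0 <= y) -> (exists x, L x 0) ->
    exists m : int, rightmost L 0 m%:~R.
  move=> [_ lL] L0 [x Lx].
  (* Minimising [y] and then maximising [x] selects the right end of the bottom edge. *)
  have [|m [k [Lmk max]]] := lL 0 (-1) 1 0.
    by rewrite mul0r sub0r mulr1 opprK oner_eq0.
  have k0 : k%:~R = 0 :> R by have := max _ _ Lx; have := L0 _ _ Lmk; lra.
  rewrite k0 in Lmk max.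
  by exists m; split=> // x' /max; lra.
have top (L : R -> R -> Prop) : lattice_body L ->
    (forall x y, L x y -> y <= p%:R) -> (exists x, L x p%:R) ->
    exists m : int, rightmost L p%:R m%:~R.
  move=> [_ lL] L0 [x Lx].
  have [|m [k [Lmk max]]] := lL 0 1 1 0.
    by rewrite mul0r sub0r mulr1 oppr_eq0 oner_eq0.
  have k0 : k%:~R = p%:R :> R by have := max _ _ Lx; have := L0 _ _ Lmk; lra.
  rewrite k0 in Lmk max.
  by exists m; split=> // x' /max; lra.
have Mp x y : mirror K x y -> 0 <= y <= p%:R by rewrite mirrorE => /Kp.
have [r0 hr0] : exists m : int, rightmost K 0 m%:~R.
  by apply: bottom => //; [move=> x y /Kp/andP[]|exists x0'].
have [r1 hr1] : exists m : int, rightmost K p%:R m%:~R.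
  by apply: top => //; [move=> x y /Kp/andP[]|exists x1'].
have [l0 hl0] : exists m : int, rightmost (mirror K) 0 m%:~R.
  apply: bottom => //; first by move=> x y /Mp/andP[].
  by exists (- x0'); rewrite mirrorE opprK.
have [l1 hl1] : exists m : int, rightmost (mirror K) p%:R m%:~R.
  apply: top => //; first by move=> x y /Mp/andP[].
  by exists (- x1'); rewrite mirrorE opprK.
have [exr [sr [sr0 srp srch srE]]] := @right_chain _ _ bK p 0%N _ _ p0 hr0 hr1.
have [exl [sl [sl0 slp slch slE]]] := @right_chain _ _ bM p 0%N _ _ p0 hl0 hl1.
rewrite !add0n in exr exl srE slE.
have [Kr0 _] := hr0; have [Kr1 _] := hr1.
have [Ml0 _] := hl0; have [Ml1 _] := hl1.
have q0 : 0 <= r0%:~R + l0%:~R :> R.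
  by have [/(mem_row _ cK hr0 hl0)] := hr0; lra.
have q1 : 0 <= r1%:~R + l1%:~R :> R.
  by have [/(mem_row _ cK hr1 hl1)] := hr1; lra.
pose A := right_area K 0 p + right_area (mirror K) 0 p.
pose s : R := r0%:~R + l0%:~R + (r1%:~R + l1%:~R).
(* The half-differences of the ends in the two chains and the ends of the top row, counted apart,
   combine to [s / 2]. *)
pose b := s / 2 + p%:R - sr - sl.
have s0 : 0 <= s by rewrite /s; lra.
exists A, b, s; split; last first.
  move=> n n0; have n0' : n%:R != 0 :> R by rewrite pnatr_eq0 -lt0n.
  have [t [tP tE]] := lattice_points_rows cK n0 Kp exr exl.
  exists t; split=> //; rewrite {}tE big_nat_recr //=.
  have -> : \sum_(0 <= j < n * p) (row_size K n j)%:~R =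
      right_floor_sum K n 0 p + right_floor_sum (mirror K) n 0 p +
      n%:R * p%:R :> R.
    rewrite /right_floor_sum muln0 -natrM -[X in _ + X%:R](subn0 (n * p)%N).
    rewrite -sumr_const_nat -!big_split /=; apply: eq_bigr => j _.
    by rewrite /row_size !intrD.
  have e : (n * p)%:R / n%:R = p%:R :> R by rewrite natrM; field.
  rewrite srE // slE // /row_size e.
  have floorE (m : int) : (Num.floor (n%:R * m%:~R : R))%:~R = n%:R * m%:~R :> R.
    by rewrite pmulrn -intrM intrKfloor.
  rewrite (rightmost_end hr1) (rightmost_end hl1) !intrD !floorE /A /b /s.
  by field.
have A1 : p%:R * s / 2 <= A.
  have h1 : p%:R * (r0%:~R + r1%:~R) / 2 <= right_area K 0 (0 + p).
    by apply: right_area_ge_segment; rewrite ?add0n.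
  have h2 : p%:R * (l0%:~R + l1%:~R) / 2 <= right_area (mirror K) 0 (0 + p).
    by apply: right_area_ge_segment; rewrite ?add0n.
  by move: h1 h2; rewrite add0n /A /s; lra.
have A2 : p%:R * (p%:R + s) / 4 <= A.
  (* For [s > p] the bound [A1] is the stronger one. *)
  have [sp|sp] := leP s p%:R; last by nra.
  have sp' : 0 <= s <= p%:R by rewrite s0.
  (* The offset [c] is that of the midpoint of the top edge from the midpoint of the bottom edge;
     offsets within [s / 2] of it are those between points [z0], [z1] of the two edges. *)
  have [k [v [/andP[v1 v2] vp]]] :=
    @centering_shear p s ((r1%:~R + l0%:~R - l1%:~R - r0%:~R) / 2) p0 sp'.
  have [w1 [w2 [u1 [u2 [Kw Ku wu]]]]] := width k.
  have [z0 [z1 [zE z0b z1b]]] : exists z0 z1 : R,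
      [/\ z1 - z0 = v - k%:~R * p%:R, - l0%:~R <= z0 <= r0%:~R &
          - l1%:~R <= z1 <= r1%:~R].
    move: v1 v2; rewrite /s; set z := v - _ => v1 v2.
    have [h|h] := leP (z + r0%:~R) r1%:~R.
      by exists r0%:~R, (z + r0%:~R); split; lra.
    by exists (r1%:~R - z), r1%:~R; split; lra.
  have Kz0 : K z0 0 by apply/(mem_row _ cK hr0 hl0).
  have Kz1 : K z1 p%:R by apply/(mem_row _ cK hr1 hl1).
  have nat_height (x : R) (y : int) : K x y%:~R ->
      exists2 y' : nat, (y' <= p)%N & y = y'%:Z.
    move=> /Kp; rewrite ler0z (pmulrn 1 p) ler_int => /andP[y0 yp].
    by exists `|y|%N; clear -y0 yp; lia.
  have [w2' w2p w2E] := nat_height _ _ Kw; have [u2' u2p u2E] := nat_height _ _ Ku.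
  rewrite {}w2E {}u2E in Kw Ku wu.
  have h1 := right_area_ge_through cK exr w2p Kz0 Kw Kz1.
  have h2 : (p%:R * - u1%:~R + u2'%:R * - z0 + (p%:R - u2'%:R) * - z1) / 2
      <= right_area (mirror K) 0 p.
    by apply: right_area_ge_through; rewrite ?mirrorE ?opprK.
  have {wu} : p%:R <= (w1%:~R + k%:~R * w2'%:R) - (u1%:~R + k%:~R * u2'%:R) :> R.
    by move: wu; rewrite -(ler_int R) !(intrD, intrN, intrM).
  move: vp; rewrite ler_norml => /andP[vp1 vp2] wu.
  have w2R : (0 <= w2'%:R :> R) && (w2'%:R <= p%:R :> R).
    by rewrite ler0n ler_nat.
  have u2R : (0 <= u2'%:R :> R) && (u2'%:R <= p%:R :> R).
    by rewrite ler0n ler_nat.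
  have z1E : z1 = z0 + v - k%:~R * p%:R by lra.
  (* By the width bound [h3] the terms in [k] cancel, leaving [p^2 / 2 - (w2' - u2') v / 2]; by [h4]
     this is at least [p^2 / 2 - p (p - s) / 4 = p (p + s) / 4]. *)
  have hA : p%:R * (w1%:~R - u1%:~R) / 2 +
     (w2'%:R - u2'%:R) * (k%:~R * p%:R - v) / 2 <= A.
    by rewrite /A; move: (lerD h1 h2); rewrite z1E; lra.
  apply: le_trans hA.
  have h3 : p%:R * (p%:R - k%:~R * (w2'%:R - u2'%:R)) <=
            p%:R * (w1%:~R - u1%:~R) :> R.
    by rewrite ler_pM2l //; lra.
  have h4 : (w2'%:R - u2'%:R) * v <= p%:R * ((p%:R - s) / 2) :> R.
    apply: le_trans (ler_norm _) _; rewrite normrM; apply: ler_pM => //.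
      by rewrite ler_norml; lra.
    by rewrite ler_norml; lra.
  lra.
split=> //.
- have [|s_le0] := ltP 0 s; first by rewrite /b; lra.
  have sE : s = 0 by lra.
  (* With both edges reduced to points, a break on either side makes [b] exceed 1. With no break the
     two chords coincide and contain [K]. *)
  suff : 2 * sr <= p%:R - 2 \/ 2 * sl <= p%:R - 2 by rewrite /b; lra.
  case: srch => [|chr]; first by left.
  case: slch => [|chl]; first by right.
  suff /eqP : p%:R = 0 :> R by rewrite gt_eqF.
  apply: (nline _ (r0%:~R - r1%:~R) (p%:R * r0%:~R)).
    move=> x y Kxy; have := chr _ _ Kxy.
    have := chl (- x) y; rewrite mirrorE opprK => /(_ Kxy).
    have -> : l0%:~R = - r0%:~R :> R by move: sE; rewrite /s; lra.
    have -> : l1%:~R = - r1%:~R :> R by move: sE; rewrite /s; lra.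
    by rewrite mulr0n subr0; lra.
- by rewrite /b; lra.
- move=> p1; rewrite p1 in hr1 hl1; rewrite /A /s p1 /right_area !big_nat1.
  rewrite (rightmost_end hr0) (rightmost_end hr1).
  by rewrite (rightmost_end hl0) (rightmost_end hl1); lra.
Qed.

End EhrhartCoefficients.

(** * Lattice width and adapted coordinates *)

Section LatticeWidth.
Variable R : realType.
Implicit Types K : R -> R -> Prop.

Definition width_in_direction K (a c : int) (w : nat) :=
  exists M N m n : int, [/\ K M%:~R N%:~R, K m%:~R n%:~R,
    forall x y, K x y -> (a * m + c * n)%:~R <= a%:~R * x + c%:~R * y
                      <= (a * M + c * N)%:~R
    & (a * M + c * N) - (a * m + c * n) = w%:Z].

Lemma ex_width K (a c : int) : lattice_body K -> (a != 0) || (c != 0) ->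
  exists w, width_in_direction K a c w.
Proof.
move=> [_ lK] ac0.
have acR : a%:~R ^+ 2 + c%:~R ^+ 2 != 0 :> R.
  rewrite paddr_eq0 ?sqr_ge0 // !sqrf_eq0 !intr_eq0 negb_and //.
(* The perpendicular form breaks ties; the determinant is [a^2 + c^2]. *)
have [|M [N [KMN maxMN]]] := lK a%:~R c%:~R (- c%:~R) a%:~R.
  by rewrite mulrN opprK -!expr2.
have [|m [n [Kmn maxmn]]] := lK (- a%:~R) (- c%:~R) (- c%:~R) a%:~R.
  by rewrite mulrNN mulNr -!expr2 -opprD oppr_eq0.
have le_MN x y : K x y -> a%:~R * x + c%:~R * y <= (a * M + c * N)%:~R.
  by move=> /maxMN; rewrite intrD !intrM; lra.
have ge_mn x y : K x y -> (a * m + c * n)%:~R <= a%:~R * x + c%:~R * y.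
  by move=> /maxmn; rewrite intrD !intrM; lra.
pose w : int := (a * M + c * N) - (a * m + c * n).
exists `|w|%N, M, N, m, n; split=> //.
  by move=> x y Kxy; rewrite ge_mn // le_MN.
have := le_MN _ _ Kmn; rewrite -!intrM -intrD ler_int => h.
by rewrite gez0_abs // /w subr_ge0.
Qed.

Definition collinear K := exists a c e : R,
  ((a != 0) || (c != 0)) /\ forall x y, K x y -> a * x + c * y = e.

(** Width 0 would make [K] collinear. A direction of least width is primitive, since dividing it by
    the gcd divides the width; hence the Bezout relation. *)
Lemma lattice_width K : lattice_body K -> ~ collinear K ->
  exists (p : nat) (a c u v : int), [/\ (0 < p)%N, u * a + v * c = 1,
    width_in_direction K a c p &
    forall a' c' w, (a' != 0) || (c' != 0) -> width_in_direction K a' c' w ->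
      (p <= w)%N].
Proof.
move=> bK ncK.
pose Q w := `[< exists a c, ((a != 0) || (c != 0)) /\
                  width_in_direction K a c w >].
have exQ : exists w, Q w.
  have [//|w hw] := @ex_width K 1 0 bK.
  by exists w; apply/asboolP; exists 1, 0.
have [p /asboolP[a [c [ac0 wp]]] pmin] := ex_minnP exQ.
have {}pmin a' c' w : (a' != 0) || (c' != 0) -> width_in_direction K a' c' w ->
    (p <= w)%N.
  by move=> ac' hw; apply: pmin; apply/asboolP; exists a', c'.
have p_gt0 : (0 < p)%N.
  rewrite lt0n; apply/eqP => p0; apply: ncK.
  case: wp => M [N [m [n [_ _ h]]]]; rewrite p0 => /eqP; rewrite subr_eq0 => /eqP e.
  exists a%:~R, c%:~R, (a * m + c * n)%:~R; rewrite !intr_eq0; split=> // x y /h.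
  by rewrite e; lra.
have [u [v uv]] := Bezoutz a c.
exists p, a, c, u, v; split=> //; rewrite {}uv.
set g := gcdz a c.
have [a' aE] : exists a', a = g * a'.
  by have /dvdzP[q ->] := dvdz_gcdl a c; exists q; rewrite mulrC.
have [c' cE] : exists c', c = g * c'.
  by have /dvdzP[q ->] := dvdz_gcdr a c; exists q; rewrite mulrC.
have g_gt0 : 0 < g by rewrite lt_neqAle eq_sym gcdz_eq0 negb_and ac0.
have ac'0 : (a' != 0) || (c' != 0).
  by move: ac0; rewrite aE cE !mulf_eq0 (gt_eqF g_gt0) /=.
have [w ww] := ex_width bK ac'0.
have pw := pmin _ _ _ ac'0 ww.
case: ww => M [N [m [n [KM Km _ wE]]]].
case: wp => M0 [N0 [m0 [n0 [_ _ h pE]]]].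
have := h _ _ KM; have := h _ _ Km.
rewrite -!intrM -!intrD !ler_int => /andP[h1 _] /andP[_ h2].
have gw : g * w%:Z <= p%:Z.
  rewrite -wE -pE [X in X <= _](_ : _ = (a * M + c * N) - (a * m + c * n)).
    lia.
  by rewrite aE cE; ring.
have : g * w%:Z <= 1 * w%:Z by rewrite mul1r (le_trans gw) // lez_nat.
rewrite ler_pM2r; first by clear -g_gt0; lia.
by rewrite ltz_nat (leq_trans p_gt0).
Qed.

(** The Bezout coefficients complete a direction of least width to a unimodular matrix. In the new
    coordinates that direction is the height, measured from a lowest lattice point [(m, n)]. *)
Lemma lattice_body_ehrhart K : lattice_body K -> ~ collinear K ->
  exists (p : nat) (A b s : R), [/\ (0 < p)%N, ehrhart_bounds p A b s &
    forall n, (0 < n)%N -> exists t, lattice_points K n t /\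
      (size t)%:R = A * n%:R ^+ 2 + b * n%:R + 1].
Proof.
move=> bK ncK.
have [p [a [c [u [v [p0 uv wp pmin]]]]]] := lattice_width bK ncK.
case: wp => M [N [m [n [KM Km h pE]]]].
pose L := affine_pullback K m n c u (- a) v.
have det1 : (c * v - u * - a) * 1 = 1 by rewrite mulr1 -uv; ring.
have uvR : u%:~R * a%:~R + v%:~R * c%:~R = 1 :> R by rewrite -!intrM -intrD uv.
have LE X Y : L (v%:~R * (X - m%:~R) - u%:~R * (Y - n%:~R))
                (a%:~R * (X - m%:~R) + c%:~R * (Y - n%:~R)) = K X Y.
  rewrite /L /affine_pullback intrN; congr (K _ _).
    rewrite [LHS](_ : _ = m%:~R + (X - m%:~R) *
      (u%:~R * a%:~R + v%:~R * c%:~R)); last by ring.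
    by rewrite uvR; ring.
  rewrite [LHS](_ : _ = n%:~R + (Y - n%:~R) *
    (u%:~R * a%:~R + v%:~R * c%:~R)); last by ring.
  by rewrite uvR; ring.
have bL : lattice_body L := lattice_body_affine m n det1 bK.
have pR : p%:R = a%:~R * (M%:~R - m%:~R) + c%:~R * (N%:~R - n%:~R) :> R.
  by rewrite pmulrn -pE intrB !intrD !intrM; ring.
have [||||x|A [b [s [bnd cnt]]]] := lattice_body_count bL p0.
- move=> x y /h; rewrite !intrN.
  have -> : a%:~R * (m%:~R + c%:~R * x + u%:~R * y) +
     c%:~R * (n%:~R + - a%:~R * x + v%:~R * y) = a%:~R * m%:~R + c%:~R * n%:~R +
       (u%:~R * a%:~R + v%:~R * c%:~R) * y :> R by ring.
  by rewrite uvR pR !intrD !intrM; lra.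
- exists 0; move: Km; rewrite -LE; congr (L _ _); ring.
- exists (v%:~R * (M%:~R - m%:~R) - u%:~R * (N%:~R - n%:~R)).
  by rewrite pR LE.
- move=> a0 c0 e0 hL; apply: contra_notP ncK => /eqP a0n0.
  exists (a0 * v%:~R + c0 * a%:~R), (c0 * c%:~R - a0 * u%:~R),
    (e0 + (a0 * v%:~R + c0 * a%:~R) * m%:~R + (c0 * c%:~R - a0 * u%:~R) * n%:~R).
  split.
    rewrite -negb_and; apply: contra a0n0 => /andP[/eqP e1 /eqP e2].
    rewrite -[a0]mulr1 -uvR.
    rewrite [X in X == 0](_ : _ = c%:~R * (a0 * v%:~R + c0 * a%:~R) -
                        a%:~R * (c0 * c%:~R - a0 * u%:~R)); last by ring.
    by rewrite e1 e2 !mulr0 subrr.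
  by move=> X Y; rewrite -LE => /hL <-; ring.
(* This is the direction first coordinate plus [x] times the height, written in the old
   coordinates. *)
- have ac' : (v + x * a != 0) || (x * c - u != 0).
    rewrite -negb_and; apply/negP => /andP[/eqP e1 /eqP e2].
    have : u * a + v * c = c * (v + x * a) - a * (x * c - u) by ring.
    by rewrite e1 e2 uv !mulr0 subrr.
  have [w ww] := ex_width bK ac'.
  have pw := pmin _ _ _ ac' ww.
  case: ww => M1 [N1 [m1 [n1 [K1 k1 _ wE]]]].
  exists (v * (M1 - m) - u * (N1 - n)), (a * (M1 - m) + c * (N1 - n)).
  exists (v * (m1 - m) - u * (n1 - n)), (a * (m1 - m) + c * (n1 - n)).
  split.
  + by move: K1; rewrite -LE !(intrD, intrN, intrM).
  + by move: k1; rewrite -LE !(intrD, intrN, intrM).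
  rewrite (_ : _ - _ =
    ((v + x * a) * M1 + (x * c - u) * N1) - ((v + x * a) * m1 + (x * c - u) * n1)).
    by rewrite wE lez_nat.
  by ring.
exists p, A, b, s; split=> // k k0.
have [t [tP tE]] := cnt k k0.
have [t' [t'P sz]] := lattice_points_affine k0 det1 tP.
by exists t'; rewrite sz.
Qed.

End LatticeWidth.

(** * Scott's inequality and the location of the roots *)

Section Scott.
Variable R : realType.

(* By Pick's formula [A - b + 1] is the number of interior lattice points and
   [2 * b] the number of boundary lattice points. *)
Lemma scott_inequality (p : nat) (A b s : R) (B i : int) : (0 < p)%N ->
  ehrhart_bounds p A b s -> B%:~R = 2 * b -> i%:~R = A - b + 1 ->
  0 <= i /\ (1 <= i -> 2 * b <= A + 4 \/ (2 * A = 9 /\ 2 * b = 9)).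
Proof.
move=> p0 [s0 b1 /andP[sb bs] [A1 A2] Ap1] BE iE.
have [p1|[p2|[p3|p4]]] : p = 1%N \/ (p = 2%N \/ (p = 3%N \/ (4 <= p)%N)) by lia.
- have i0 : i = 0.
    apply/eqP; rewrite -(intr_eq0 R) iE (Ap1 p1).
    by rewrite p1 in bs; apply/eqP; lra.
  by rewrite i0.
- rewrite {}p2 in bs A1 A2.
  have i0 : 0 <= i by rewrite -(ler0z R) iE; lra.
  by split=> // _; left; lra.
- rewrite {}p3 in bs A1 A2.
  have i0 : 0 <= i by rewrite -(ler0z R) iE; lra.
  split=> // i1; have [s4|s4] := leP 4 s; first by left; lra.
  have iB : B - 8 <= 2 * i.
    rewrite -ltzD1 -(ltr_int R) !(intrD, intrN, intrM) BE iE; lra.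
  have [h|h] := leP (B - 6) (2 * i).
    left; move: h; rewrite -(ler_int R) !(intrD, intrN, intrM) BE iE; lra.
  have B9 : B < 10 by rewrite -(ltr_int R) BE; lra.
  have B9' : B = 9 by lia.
  have i1' : i = 1 by lia.
  by right; move: BE iE; rewrite B9' i1'; lra.
- have p4' : 4 <= p%:R :> R by rewrite ler_nat.
  have i0 : 0 <= i.
    by rewrite -(ler0z R) iE; nra.
  (* [A + 4 - 2 b] is at least [(p - 4)^2 / 4 + s (p - 4) / 4]. *)
  split=> // _; left; nra.
Qed.

(** The two equations are the real and imaginary parts of [A z^2 + b z + 1 = 0] at [z = x + i y],
    with the imaginary unit in place of the count [i]. *)
Lemma quadratic_root_location (p : nat) (A b s : R) (B i : int) (x y : R) :
  (0 < p)%N -> ehrhart_bounds p A b s -> B%:~R = 2 * b -> i%:~R = A - b + 1 ->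
  A * (x ^+ 2 - y ^+ 2) + b * x + 1 = 0 -> y * (2 * A * x + b) = 0 ->
  (y = 0 /\ [\/ x = - 2, x = - 1 | x = - (2 / 3)]) \/
  (- (1 / 2) <= x < 0 /\ `|y| <= Num.sqrt 15 / 6).
Proof.
move=> p0 bnd BE iE reE imE.
have [i0 scott] := scott_inequality p0 bnd BE iE.
case: bnd => s0 b1 _ [_ A2] _.
have p1 : 1 <= p%:R :> R by rewrite ler1n.
have A0 : 0 < A by nra.
have sqrt0 : 0 <= Num.sqrt 15 / 6 :> R by rewrite divr_ge0 ?sqrtr_ge0.
have y2E : y != 0 -> x = - b / (2 * A) /\ 4 * A ^+ 2 * y ^+ 2 = 4 * A - b ^+ 2.
  move=> y0; move/eqP: imE; rewrite mulf_eq0 (negbTE y0) /= => /eqP e.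
  have xE : x = - b / (2 * A).
    rewrite (_ : - b = 2 * A * x); last by lra.
    by field; rewrite gt_eqF.
  split=> //; have : 4 * A * (A * (x ^+ 2 - y ^+ 2) + b * x + 1) = 0.
    by rewrite reE mulr0.
  have -> : b = - (2 * A * x) by lra.
  lra.
have B3 : 2 < B by rewrite -(ltr_int R) BE; lra.
have b32 : 3 / 2 <= b.
  have : 3 <= B by lia.
  by rewrite -(ler_int R) BE; lra.
have [i_le0|i_gt0] := leP i 0.
(* Without interior points the polynomial is [(z + 1) (A z + 1)], with [A = (B - 2) / 2]. The values
   [B = 3, 4, 5] give the isolated roots, and [B >= 6] gives [A >= 2]. *)
- have bA : b = A + 1.
    have : i%:~R = 0 :> R by rewrite (_ : i = 0) //; lia.
    by rewrite iE; lra.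
  have y0 : y = 0.
    apply/eqP; apply/negP => /negP y0; have [_ h] := y2E y0.
    have : 0 < A ^+ 2 * y ^+ 2.
      by rewrite -exprMn exprn_even_gt0 // mulf_neq0 // gt_eqF.
    by have := sqr_ge0 (A - 1); rewrite bA in h; nra.
  rewrite y0 expr0n subr0 bA in reE.
  have /eqP : (x + 1) * (A * x + 1) = 0 by rewrite -[RHS]reE; ring.
  rewrite mulf_eq0 => /orP[] /eqP e.
    by left; split=> //; apply: Or32; lra.
  have xE : x = - A^-1.
    rewrite -[x]mul1r -(mulVf (lt0r_neq0 A0)) -mulrA.
    by rewrite (_ : A * x = - 1) ?mulrN1 //; lra.
  have AE : A = (B - 2)%:~R / 2 by rewrite intrB BE; lra.
  have [e1|[e2|[e3|e4]]] : B = 3 \/ (B = 4 \/ (B = 5 \/ 6 <= B)) by lia.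
  + by left; split=> //; apply: Or31; rewrite xE AE e1; field.
  + by left; split=> //; apply: Or32; rewrite xE AE e2; field.
  + by left; split=> //; apply: Or33; rewrite xE AE e3; field.
  right; rewrite y0 normr0; split=> //.
  have A4 : 2 <= A by move: e4; rewrite -(ler_int R) BE; lra.
  by nra.
- have {scott} : 2 * b <= A + 4 \/ (2 * A = 9 /\ 2 * b = 9) by apply: scott; lia.
  have bA : b <= A.
    have : (1 <= i) by lia.
    by rewrite -(ler_int R) iE; lra.
  move=> [bA4|[A9 b9]]; last first.
    have AE : A = 9 / 2 by lra.
    have bE : b = 9 / 2 by lra.
    have y0 : y = 0.
      apply/eqP; apply/negP => /negP y0; have [_ h] := y2E y0.
      have : 0 < y ^+ 2 by rewrite exprn_even_gt0.
      by rewrite AE bE in h; nra.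
    rewrite y0 expr0n subr0 AE bE in reE.
    have /eqP : (3 * x + 1) * (3 * x + 2) = 0 by lra.
    rewrite mulf_eq0 => /orP[] /eqP e.
      by right; rewrite y0 normr0; split=> //; lra.
    by left; split=> //; apply: Or33; lra.
  right; have [y0|/y2E[xE h]] := eqVneq y 0.
    rewrite y0 expr0n subr0 in reE; rewrite y0 normr0; split=> //.
    have x_lt0 : x < 0 by rewrite ltNge; apply/negP => x0; nra.
    rewrite x_lt0 andbT leNgt; apply/negP => xh.
    (* The product is the value of the quadratic at [x] minus its value at [-1/2], and the latter is
       nonnegative because [2 b <= A + 4]. *)
    have : 0 < (- x - 1 / 2) * (A * (1 / 2 - x) - b) by apply: mulr_gt0; nra.
    by nra.
  split.
    rewrite xE mulNr lerN2 oppr_lt0 divr_gt0 ?andbT; [|lra|lra].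
    by rewrite ler_pdivrMr; lra.
  rewrite ler_pdivlMr // -[6]ger0_norm // -normrM -sqrtr_sqr ler_sqrt ?ler0n //.
  rewrite exprMn.
  (* This is [y^2 <= 15 / 36] with denominators cleared. As [b >= 3/2], the right side is at least
     [5 (A - 9/10) (A - 3/2)], and [A >= b >= 3/2]. *)
  have hq : 0 <= 5 * A ^+ 2 - 12 * A + 3 * b ^+ 2 by nra.
  have A2_gt0 : 0 < 4 * A ^+ 2 by rewrite mulr_gt0 ?exprn_gt0.
  rewrite -(ler_pM2l A2_gt0); lra.
Qed.

End Scott.

(** * From lattice polytopes to lattice bodies *)

Section Polygon.
Variable R : realType.
Implicit Types P : set 'rV[R]_2.

Definition vec (x y : R) : 'rV[R]_2 := \row_j (if j == ord0 then x else y).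

Lemma vecE (v : 'rV[R]_2) : v = vec (v ord0 ord0) (v ord0 ord_max).
Proof.
apply/rowP => j; rewrite mxE; case: eqP => [->//|/eqP j0].
by congr (v _ _); apply/val_inj; case: j j0 => -[|[|]].
Qed.

Lemma vec0 x y : vec x y ord0 ord0 = x. Proof. by rewrite mxE eqxx. Qed.

Lemma vec1 x y : vec x y ord0 ord_max = y. Proof. by rewrite mxE. Qed.

Lemma vec_inj x y x' y' : vec x y = vec x' y' -> x = x' /\ y = y'.
Proof.
by move=> e; rewrite -(vec0 x y) -{2}(vec1 x y) e vec0 vec1.
Qed.

Lemma vec_lin t x y x' y' : t *: vec x y + (1 - t) *: vec x' y' =
  vec (t * x + (1 - t) * x') (t * y + (1 - t) * y').
Proof. by apply/rowP => j; rewrite !mxE; case: eqP. Qed.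

Lemma convex_hull_convex (S : set 'rV[R]_2) (u v : 'rV[R]_2) (t : R) :
  0 <= t <= 1 -> convex_hull S u -> convex_hull S v ->
  convex_hull S (t *: u + (1 - t) *: v).
Proof.
move=> /andP[t0 t1] Su Sv M [cM SM].
have := cM u v (Itv01 t0 t1) (mem_set (Su M _)) (mem_set (Sv M _)).
by rewrite inE; apply.
Qed.

Lemma seq_lex_max (T : eqType) (f g : T -> R) (s : seq T) : s != [::] ->
  exists2 v, v \in s & forall x, x \in s ->
    f x < f v \/ f x = f v /\ g x <= g v.
Proof.
elim: s => // a [|b s] IH _.
  by exists a; rewrite ?mem_head // => x; rewrite inE => /eqP ->; right.
have [//|v vs vmax] := IH.
have [fg|fg] : (f a < f v \/ f a = f v /\ g a <= g v) \/
   (f v < f a \/ f v = f a /\ g v <= g a).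
- have [h|h|e] := ltgtP (f a) (f v); [by left; left|by right; left|].
  by have [|/ltW] := leP (g a) (g v); [left; right|right; right].
- exists v; first by rewrite in_cons vs orbT.
  by move=> x; rewrite in_cons => /orP[/eqP ->|/vmax].
- exists a; first exact: mem_head.
  move=> x; rewrite in_cons => /orP[/eqP ->|/vmax]; first by right.
  lra.
Qed.

(** A lexicographic maximum over the finite generating set is one over the hull, because the points
    lexicographically below it form a convex set. Two independent forms make it an extreme point,
    hence a lattice point. *)
Lemma lattice_polytope_body P : lattice_polytope P -> P !=set0 ->
  lattice_body (fun x y => P (vec x y)).
Proof.
move=> [[S finS PE] latP] [u Pu]; split.
  move=> x y x' y' t t01; rewrite -vec_lin PE.
  exact: convex_hull_convex.
move=> a b c d det0.
pose f (v : 'rV[R]_2) := a * v ord0 ord0 + b * v ord0 ord_max.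
pose g (v : 'rV[R]_2) := c * v ord0 ord0 + d * v ord0 ord_max.
have [s SE] := (finite_seqP S).1 finS.
have s0 : s != [::].
  apply/eqP => s0; rewrite PE in Pu.
  apply: (Pu set0); split; last by rewrite SE s0 => x.
  by move=> x y t; rewrite in_set0.
have [v vs vmax] := seq_lex_max f g s0.
have Pv : P v by rewrite PE => M [_ +]; apply; rewrite SE.
have {}vmax x : P x -> f x < f v \/ f x = f v /\ g x <= g v.
  rewrite PE => Px.
  have := Px [set x | f x < f v \/ f x = f v /\ g x <= g v]; apply.
  split=> [x1 x2 t|x1]; last by rewrite SE; exact: vmax.
  rewrite !inE /= => h1 h2.
  rewrite -[conv _ _ _]/((t%:num *: x1 + (1 - t%:num) *: x2) : 'rV[R]_2).
  have t0 : 0 <= t%:num by []; have t1 : t%:num <= 1 by [].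
  have fE : f (t%:num *: x1 + (1 - t%:num) *: x2) =
            t%:num * f x1 + (1 - t%:num) * f x2 by rewrite /f !mxE; ring.
  have gE : g (t%:num *: x1 + (1 - t%:num) *: x2) =
            t%:num * g x1 + (1 - t%:num) * g x2 by rewrite /g !mxE; ring.
  rewrite fE gE; move: (t%:num) t0 t1 => r r0 r1.
  case: h1 => [h1|[e1 h1]]; case: h2 => [h2|[e2 h2]].
  - left; have [->|rn0] := eqVneq r 0; first by lra.
    have : 0 < r by rewrite lt_neqAle eq_sym rn0.
    nra.
  - have [->|rn0] := eqVneq r 0; first by right; split; lra.
    left; rewrite e2; have : 0 < r by rewrite lt_neqAle eq_sym rn0.
    nra.
  - have [->|rn1] := eqVneq r 1; first by right; split; lra.
    left; rewrite e1; have : r < 1 by rewrite lt_neqAle rn1.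
    nra.
  - right; rewrite e1 e2; split; first by ring.
    nra.
have vertv : vertex P v.
  split=> // x y t Px Py /andP[t0 t1] e.
  have fE : f v = t * f x + (1 - t) * f y by rewrite {1}e /f !mxE; ring.
  have gE : g v = t * g x + (1 - t) * g y by rewrite {1}e /g !mxE; ring.
  have fg_inj w : f w = f v -> g w = g v -> w = v.
    move=> e1 e2; rewrite [w]vecE [v]vecE; congr vec; apply: (mulfI det0).
      by transitivity (d * f w - b * g w); [|rewrite e1 e2]; rewrite /f /g; ring.
    by transitivity (a * g w - c * f w); [|rewrite e1 e2]; rewrite /f /g; ring.
  have [hx hy] := (vmax x Px, vmax y Py).
  have fx : f x = f v by case: hx; case: hy; nra.
  have fy : f y = f v by case: hx; case: hy; nra.
  by split; apply: fg_inj => //; case: hx; case: hy; nra.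
have latv := latP v vertv.
have [m mE] := latv ord0; have [k kE] := latv ord_max.
exists m, k; rewrite -mE -kE -vecE; split=> // x y /vmax.
by rewrite /f /g vec0 vec1.
Qed.

(** On a line [a x + c y = e] all differences are multiples of [(- c, a)], which span dimension at
    most 1. *)
Lemma has_dimension2_not_collinear P : has_dimension P 2 ->
  ~ collinear (fun x y => P (vec x y)).
Proof.
move=> [_ [U [_ Umin dimU]]] [a [c [e [ac0 line]]]].
have ac2 : a ^+ 2 + c ^+ 2 != 0.
  by rewrite paddr_eq0 ?sqr_ge0 // !sqrf_eq0 negb_and.
have /dimvS : (U <= <[vec (- c) a]>)%VS.
  apply: Umin => x y; rewrite (vecE x) (vecE y) => /line ex /line ey.
  set x0 := x ord0 ord0 in ex *; set x1 := x ord0 ord_max in ex *.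
  set y0 := y ord0 ord0 in ey *; set y1 := y ord0 ord_max in ey *.
  have exy : a * (x0 - y0) = - c * (x1 - y1) by lra.
  apply/vlineP; exists ((a * (x1 - y1) - c * (x0 - y0)) / (a ^+ 2 + c ^+ 2)).
  apply/rowP => j; rewrite !mxE; apply: (mulIf ac2).
  rewrite mulrAC divfK //; case: eqP => _.
    transitivity (a * (a * (x0 - y0)) + c ^+ 2 * (x0 - y0)); first by ring.
    by rewrite exy; ring.
  transitivity (a ^+ 2 * (x1 - y1) - c * (- c * (x1 - y1))); first by ring.
  by rewrite -exy; ring.
by rewrite dimU dim_vline; case: (_ != 0).
Qed.

Lemma lattice_count_points P n t : (0 < n)%N ->
  lattice_points (fun x y => P (vec x y)) n t ->
  lattice_count (dilate n P) = size t.
Proof.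
move=> n0 [ut tP].
have n0' : n%:R != 0 :> R by rewrite pnatr_eq0 -lt0n.
pose F (z : int * int) := vec z.1%:~R z.2%:~R.
have Finj : injective F.
  by move=> [x y] [x' y'] /vec_inj /= [/intr_inj -> /intr_inj ->].
have -> : lattice_count (dilate n P) = #|` [fset v in map F t]%fset|.
  rewrite /lattice_count; congr (#|` _|); rewrite -[RHS]set_fsetK; congr fset_set.
  apply/seteqP; split=> v /=; rewrite ?inE.
    move=> [[u Pu <-] lat]; have [m mE] := lat ord0; have [k kE] := lat ord_max.
    apply/mapP; exists (m, k); last by rewrite /F /= -mE -kE -vecE.
    apply/tP; rewrite -mE -kE !mxE !(mulrC n%:R) !mulfK // -vecE //.
  move=> /mapP[[m k] /tP Pmk ->]; split.
    exists (vec (m%:~R / n%:R) (k%:~R / n%:R)) => //.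
    by apply/rowP => j; rewrite !mxE; case: eqP => _; rewrite mulrC divfK.
  by move=> j; rewrite mxE /=; case: eqP => _; [exists m|exists k].
by rewrite card_fseq undup_id ?size_map // map_inj_uniq.
Qed.

Lemma lattice_count_dilate0 P : P !=set0 -> lattice_count (dilate 0 P) = 1%N.
Proof.
move=> [u Pu]; rewrite /lattice_count.
have -> : dilate 0 P `&` @lattice R 2 = [set` [fset (0 : 'rV[R]_2)]%fset].
  apply/seteqP; split=> v /=; rewrite ?inE.
    by move=> [[w _ <-] _]; rewrite scale0r.
  move=> /eqP ->; split; first by exists u; rewrite ?scale0r.
  by move=> j; exists 0; rewrite mxE.
by rewrite set_fsetK cardfs1.
Qed.

End Polygon.

(** * Identification of the Ehrhart polynomial and its complex roots *)

Lemma poly_nat_eq (F : numDomainType) (p q : {poly F}) :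
  (forall n : nat, p.[n%:R] = q.[n%:R]) -> p = q.
Proof.
move=> pq; apply/eqP; rewrite -subr_eq0; apply/negPn/negP => r0.
pose s := [seq n%:R : F | n <- iota 0 (size (p - q))].
have us : uniq s.
  rewrite map_inj_uniq ?iota_uniq // => m n /eqP.
  by rewrite eqr_nat => /eqP.
have rs : all (root (p - q)) s.
  by apply/allP => _ /mapP[n _ ->]; rewrite rootE hornerD hornerN pq subrr.
by have := max_poly_roots r0 rs us; rewrite size_map size_iota ltnn.
Qed.

Theorem theorem2p2 (R : realType) (P : set 'rV[R]_2) (i_P : {poly R[i]}) :
  lattice_polytope P ->
  has_dimension P 2 ->
  is_ehrhart_poly P i_P ->
  forall z : R[i], root i_P z ->
    ([set - 2; - 1; - (2 / 3)] `|`
     [set w : R[i] | - (1 / 2) <= complex.Re w < 0 /\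
                     `|complex.Im w| <= Num.sqrt 15 / 6]) z.
Proof.
move=> latP dimP ehrP z.
have P0 := dimP.1.
have [p [A [b [s [p0 bnd cnt]]]]] := lattice_body_ehrhart
  (lattice_polytope_body latP P0) (has_dimension2_not_collinear dimP).
have [t1 [t1P t1E]] := cnt 1%N isT.
have [t2 [_ t2E]] := cnt 2%N isT.
have iE : i_P = (A%:C)%C *: 'X^2 + (b%:C)%C *: 'X + 1%:P.
  apply: poly_nat_eq => n.
  rewrite ehrP !(hornerD, hornerZ, hornerXn, hornerX, hornerC).
  case: (posnP n) => [->|n0].
    by rewrite lattice_count_dilate0 // mulr0n expr0n !mulr0 !add0r.
  have [t [tP tE]] := cnt n n0; rewrite (lattice_count_points n0 tP).
  rewrite -(rmorph_nat (real_complex R) (size t)) tE.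
  by rewrite !rmorphD rmorph1 rmorphM rmorphXn rmorphM !rmorph_nat.
(* The counts at 1 and 2 are [A + b + 1] and [4 A + 2 b + 1]. Eliminating [A] shows that [2 b] is an
   integer. *)
pose B : int := 4 * (size t1)%:Z - (size t2)%:Z - 3.
have BE : B%:~R = 2 * b.
  by rewrite /B !intrB intrM -!pmulrn t1E t2E; ring.
have IE : ((size t1)%:Z - B)%:~R = A - b + 1.
  by rewrite intrB BE -pmulrn t1E; ring.
rewrite iE rootE !(hornerD, hornerZ, hornerXn, hornerX, hornerC) expr2.
case: z => x y; rewrite eq_complex /= => /andP[/eqP re /eqP im].
have [||[y0 xE]|?] := @quadratic_root_location R p A b s B _ x y p0 bnd BE IE.
- by rewrite -[RHS]re; ring.
- by rewrite -[RHS]im; ring.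
- left; rewrite y0.
  case: xE => ->; [left; left|left; right|right].
  + by rewrite /= -[2 in RHS](rmorph_nat (real_complex R)) -rmorphN.
  + by rewrite /= -(rmorph1 (real_complex R)) -rmorphN.
  + rewrite /= -[2 in RHS](rmorph_nat (real_complex R)).
    by rewrite -[3 in RHS](rmorph_nat (real_complex R)) -fmorph_div -rmorphN.
- by right.
Qed.
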